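(* If $G$ and $H$ are graphs, then $\iota(G\,\Box\, H)\ge \max\{\rho_2(G)\iota(H),\ \rho_2(H)\iota(G)\}$.
   Context: All graphs are finite and simple; $\Box$ is the Cartesian product. A $2$-packing is a set of vertices whose closed neighborhoods are pairwise disjoint; $\rho_2(G)$ is the maximum size of a $2$-packing. A set $A$ of vertices is isolating if no two vertices outside the closed neighborhood $N[A]$ are adjacent; $\iota$ is the minimum size of an isolating set. *)

(* Defs.v *)
From mathcomp Require Import all_boot.

Set Implicit Arguments.
Unset Strict Implicit.
Unset Printing Implicit Defensive.

Record sgraph := SGraph {
  vertex :> finType;
  adj : rel vertex;
  adj_sym : symmetric adj;
  adj_irrefl : irreflexive adj }.

Section CartesianProduct.
Variables G H : sgraph.

Definition cart_adj : rel (G * H)%type := fun x y =>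
  (x.1 == y.1) && adj x.2 y.2 || (x.2 == y.2) && adj x.1 y.1.

Lemma cart_adj_sym : symmetric cart_adj.
Proof.
move=> x y; rewrite /cart_adj (eq_sym x.1) (eq_sym x.2).
by rewrite (adj_sym x.1) (adj_sym x.2).
Qed.

Lemma cart_adj_irrefl : irreflexive cart_adj.
Proof. by move=> x; rewrite /cart_adj !adj_irrefl !andbF. Qed.

Definition cart_prod : sgraph := SGraph cart_adj_sym cart_adj_irrefl.

End CartesianProduct.

Notation "G □ H" := (cart_prod G H) (at level 40, left associativity).

Section Invariants.
Variable G : sgraph.

Definition closed_nbh (v : G) : {set G} := [set u | (u == v) || adj v u].

Definition closed_nbhs (A : {set G}) : {set G} :=
  \bigcup_(v in A) closed_nbh v.

Definition two_packing (A : {set G}) : bool :=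
  [forall u in A, forall v in A,
     (u != v) ==> [disjoint closed_nbh u & closed_nbh v]].

Definition rho2 : nat := \max_(A : {set G} | two_packing A) #|A|.

Definition isolating (A : {set G}) : bool :=
  [forall x, forall y,
     (x \notin closed_nbhs A) && (y \notin closed_nbhs A) ==> ~~ adj x y].

Lemma isolatingT : isolating [set: G].
Proof.
apply/forallP=> x; apply/forallP=> y; apply/implyP=> /andP[/negP[]].
by apply/bigcupP; exists x; rewrite ?inE ?eqxx.
Qed.

(* By isolatingT the default value of arg min is isolating, so this is the
   true minimum. *)
Definition iota_num : nat :=
  #|[arg min_(A < [set: G] | isolating A) #|A|]|.

End Invariants.

(* Main.v *)
Require Import Defs.
From mathcomp Require Import all_boot.

Set Implicit Arguments.
Unset Strict Implicit.
Unset Printing Implicit Defensive.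

(** Let [D] isolate [G □ H] and let [A] be a 2-packing of [G].  For each [v] in
    [A], the vertices of the fibre [{v} × H] are dominated only from the slab
    [N[v] × H], so the projection of [D :&: (N[v] × H)] to [H] isolates [H].
    These slabs are pairwise disjoint, whence [#|D| >= #|A| * iota(H)]; the
    other bound follows by commutativity of [□]. *)

Lemma isolatingP (G : sgraph) (A : {set G}) :
  reflect (forall x y, adj x y ->
             (x \in closed_nbhs A) || (y \in closed_nbhs A))
          (isolating A).
Proof.
apply: (iffP idP) => [/forallP isoA x y xy | isoA].
  have /forallP/(_ y) := isoA x.
  by rewrite xy implybF negb_and !negbK.
apply/forallP=> x; apply/forallP=> y; apply/implyP; rewrite -negb_or.
exact: contra (isoA x y).
Qed.

Lemma iota_num_min (G : sgraph) (A : {set G}) :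
  isolating A -> iota_num G <= #|A|.
Proof.
move=> isoA; rewrite /iota_num.
by case: arg_minnP => [|B _ minB]; [exact: isolatingT | exact: minB].
Qed.

Lemma iota_num_witness (G : sgraph) :
  exists2 A : {set G}, isolating A & #|A| = iota_num G.
Proof.
rewrite /iota_num; case: arg_minnP => [|A isoA _]; first exact: isolatingT.
by exists A.
Qed.

Lemma rho2_witness (G : sgraph) :
  exists2 A : {set G}, two_packing A & #|A| = rho2 G.
Proof.
(* The empty packing makes the family nonempty, so the maximum is attained. *)
have pack0 : two_packing (set0 : {set G}).
  by apply/forallP=> u; rewrite inE.
rewrite /rho2 (bigmax_eq_arg _ pack0) //.
by case: arg_maxnP => // A packA _; exists A.
Qed.

(** Swapping coordinates is an isomorphism of the two products, so it carries a minimum isolating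
    set to an isolating set. *)
Lemma iota_num_cartC (G H : sgraph) : iota_num (H □ G) <= iota_num (G □ H).
Proof.
have [D /isolatingP isoD <-] := iota_num_witness (G □ H).
pose swapGH (x : G □ H) : H □ G := (x.2, x.1).
pose swapHG (x : H □ G) : G □ H := (x.2, x.1).
have adj_swap x y : adj (swapHG x) (swapHG y) = adj x y.
  by rewrite /= /cart_adj /= orbC.
have nbhs_swap x : swapHG x \in closed_nbhs D ->
    x \in closed_nbhs [set swapGH d | d in D].
  case/bigcupP=> d dD; rewrite inE => xd.
  apply/bigcupP; exists (swapGH d); first exact: imset_f.
  rewrite inE -adj_swap; case: x d xd {dD} => [h g] [g' h'].
  by rewrite /= !xpair_eqE [(h == _) && _]andbC.
apply: leq_trans (leq_imset_card swapGH (mem D)).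
apply/iota_num_min/isolatingP => x y; rewrite -adj_swap => /isoD.
by case/orP=> /nbhs_swap ->; rewrite ?orbT.
Qed.

Section Slab.

Variables (G H : sgraph) (D : {set G □ H}).

Definition slab (v : G) : {set G □ H} := [set d in D | d.1 \in closed_nbh v].

Lemma isolating_slab (v : G) :
  isolating D -> isolating [set d.2 | d in slab v].
Proof.
move/isolatingP=> isoD.
have dominated h : ((v, h) : G □ H) \in closed_nbhs D ->
    h \in closed_nbhs [set d.2 | d in slab v].
  (* A dominator [(a, b)] equals [(v, h)] or differs from it by an edge in one coordinate; in every
     case [a] lies in [closed_nbh v] and [b] dominates [h]. *)
  case/bigcupP=> -[a b] dD; rewrite inE /= /cart_adj /= xpair_eqE => vh.
  apply/bigcupP; exists b.
    apply/imsetP; exists (a, b) => //; rewrite !inE dD /=.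
    case/or3P: vh => /andP[].
    - by rewrite eq_sym => ->.
    - by move=> ->.
    - by rewrite adj_sym orbC => _ ->.
  rewrite inE; case/or3P: vh => /andP[].
  - by move=> _ ->.
  - by move=> _ ->; rewrite orbT.
  - by rewrite eq_sym => ->.
apply/isolatingP=> h k hk.
(* An edge of [H] lifts to the fibre over [v], where [D] dominates one of its ends. *)
have vhk : adj ((v, h) : G □ H) (v, k) by rewrite /= /cart_adj /= eqxx hk.
by case/orP: (isoD _ _ vhk) => /dominated ->; rewrite ?orbT.
Qed.

Lemma sum_card_slab (A : {set G}) :
  two_packing A -> \sum_(v in A) #|slab v| <= #|D|.
Proof.
move/forall_inP=> packA.
(* Double counting: after exchanging the sums, [d] contributes the number of [v] in [A] with [d.1]
   in [closed_nbh v]. *)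
have slab_card v : #|slab v| = \sum_(d in D) (d.1 \in closed_nbh v).
  rewrite -sum1_card big_mkcond [RHS]big_mkcond /=; apply: eq_bigr => d _.
  by rewrite inE; case: (d \in D); case: (_ \in _).
rewrite (eq_bigr _ (fun v _ => slab_card v)) exchange_big /= -sum1_card.
apply: leq_sum => d _.
(* Disjointness of the closed neighborhoods allows at most one such [v]. *)
case: (pickP [pred v in A | d.1 \in closed_nbh v]) => [v /andP[vA dv] | no_v].
  rewrite (bigD1 v) //= dv big1 // => u /andP[uA uv].
  have /forall_inP/(_ v vA)/implyP/(_ uv) := packA u uA.
  by case: (boolP (d.1 \in closed_nbh u)) => // du /disjointFr/(_ du); rewrite dv.
by rewrite big1 // => v vA; have /= := no_v v; rewrite vA /= => ->.
Qed.

End Slab.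

Lemma rho2_iota_le (G H : sgraph) : rho2 G * iota_num H <= iota_num (G □ H).
Proof.
have [D isoD <-] := iota_num_witness (G □ H).
have [A packA <-] := rho2_witness G.
(* The product becomes a constant sum over [A], compared termwise with the slab sizes; projecting a
   slab to [H] cannot enlarge it. *)
apply: leq_trans (sum_card_slab D packA); rewrite -sum_nat_const.
apply: leq_sum => v _.
apply: leq_trans (iota_num_min (isolating_slab v isoD)) _.
exact: leq_imset_card.
Qed.

Theorem theorem3p6 (G H : sgraph) :
  iota_num (G □ H) >= maxn (rho2 G * iota_num H) (rho2 H * iota_num G).
Proof.
rewrite geq_max rho2_iota_le /=.
exact: leq_trans (rho2_iota_le H G) (iota_num_cartC G H).
Qed.
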